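(* Let $M$ be a matroid on a finite ground set $S$ with rank function $r$, and let $\Delta$ be a non-void strong pseudo-independence complex over $M$. Then $(S,\Delta,r|_{\Delta})$ is a semimatroid.
   Context: Let $\Delta$ be a simplicial complex over $S$ (a family of subsets of $S$ closed under subsets). $\Delta$ is a pseudo-independence complex over $M$ if whenever $\sigma\in\Delta$, $x\in S\setminus\sigma$ and $r(\sigma\cup\{x\})>r(\sigma)$, then $\sigma\cup\{x\}\in\Delta$. It is a strong pseudo-independence complex over $M$ if in addition, whenever $\sigma\in\Delta$, $x\in S\setminus\sigma$, $r(\sigma\cup\{x\})=r(\sigma)$ and $\sigma\cup\{x\}\in\Delta$, then $x$ is a cone point of $\mathrm{lk}_\sigma(\Delta)=\{\tau:\tau\cap\sigma=\emptyset,\ \tau\cup\sigma\in\Delta\}$, i.e. $\tau\cup\{x\}\in\mathrm{lk}_\sigma(\Delta)$ for all $\tau\in\mathrm{lk}_\sigma(\Delta)$. A semimatroid is a triple $(S,\Delta,r)$ with $\Delta$ a non-void simplicial complex over $S$ and $r:\Delta\to\mathbb{N}$ such that for all $\sigma,\tau\in\Delta$: (i) $0\le r(\sigma)\le|\sigma|$; (ii) $\sigma\subseteq\tau\Rightarrow r(\sigma)\le r(\tau)$; (iii) if $\sigma\cup\tau\in\Delta$ then $r(\sigma)+r(\tau)\ge r(\sigma\cup\tau)+r(\sigma\cap\tau)$; (iv) if $r(\sigma)=r(\sigma\cap\tau)$ then $\sigma\cup\tau\in\Delta$; (v) if $r(\sigma)<r(\tau)$ there is $y\in\tau\setminus\sigma$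 with $\sigma\cup\{y\}\in\Delta$. *)

(* Defs.v *)
From HB Require Import structures.
From mathcomp Require Import all_boot.

Set Implicit Arguments.
Unset Strict Implicit.
Unset Printing Implicit Defensive.

Record matroid (S : finType) : Type := Matroid {
  indep : {set {set S}};
  indep0 : set0 \in indep;
  indepS : forall I J : {set S}, J \in indep -> I \subset J -> I \in indep;
  indep_exchange : forall I J : {set S}, I \in indep -> J \in indep ->
    #|I| < #|J| -> exists2 x, x \in J :\: I & x |: I \in indep
}.

Definition rank (S : finType) (M : matroid S) (A : {set S}) : nat :=
  \max_(I in indep M | I \subset A) #|I|.

Section Complexes.

Variable S : finType.
Implicit Types (Delta Gamma : {set {set S}}) (M : matroid S).
Implicit Types (sigma tau : {set S}) (x y : S).

(* The void complex (no faces at all) is allowed, and a point of S need not be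
   a vertex. *)
Definition simplicial_complex Delta : Prop :=
  forall sigma tau, tau \in Delta -> sigma \subset tau -> sigma \in Delta.

Definition link sigma Delta : {set {set S}} :=
  [set tau : {set S} | [disjoint tau & sigma] & tau :|: sigma \in Delta].

Definition cone_point Gamma x : Prop :=
  forall tau, tau \in Gamma -> x |: tau \in Gamma.

Definition pseudo_independence_complex M Delta : Prop :=
  simplicial_complex Delta /\
  forall sigma x, sigma \in Delta -> x \notin sigma ->
    rank M sigma < rank M (x |: sigma) -> x |: sigma \in Delta.

Definition strong_pseudo_independence_complex M Delta : Prop :=
  pseudo_independence_complex M Delta /\
  forall sigma x, sigma \in Delta -> x \notin sigma ->
    rank M (x |: sigma) = rank M sigma -> x |: sigma \in Delta ->
    cone_point (link sigma Delta) x.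

(* The rank of a semimatroid is a function on Delta. It is encoded by a total
   function r of which only the values on Delta matter: every argument of r
   below is a face (sigma :&: tau is one because Delta is closed under
   subsets). Hence [semimatroid Delta r] is a statement about r|_Delta. *)
Record semimatroid Delta (r : {set S} -> nat) : Prop := Semimatroid {
  semimatroid_nonvoid : Delta != set0;
  semimatroid_complex : simplicial_complex Delta;
  semimatroid_rank_card : forall sigma, sigma \in Delta ->
    0 <= r sigma <= #|sigma|;
  semimatroid_rank_mono : forall sigma tau, sigma \in Delta -> tau \in Delta ->
    sigma \subset tau -> r sigma <= r tau;
  semimatroid_rank_submod : forall sigma tau,
    sigma \in Delta -> tau \in Delta -> sigma :|: tau \in Delta ->
    r (sigma :|: tau) + r (sigma :&: tau) <= r sigma + r tau;
  semimatroid_union : forall sigma tau, sigma \in Delta -> tau \in Delta ->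
    r sigma = r (sigma :&: tau) -> sigma :|: tau \in Delta;
  semimatroid_augment : forall sigma tau, sigma \in Delta -> tau \in Delta ->
    r sigma < r tau -> exists2 y, y \in tau :\: sigma & y |: sigma \in Delta
}.

End Complexes.

(* Main.v *)
Require Import Defs.
From mathcomp Require Import all_boot.

(** Rank monotonicity, submodularity and the augmentation axiom come from the
    matroid: a point of an independent subset of [tau] which enlarges a basis of
    [sigma] raises the rank of [sigma], so the pseudo-independence condition adds
    it to [sigma]. For the union axiom put [rho = sigma :&: tau]: when
    [sigma] and [rho] have the same rank, no point of [sigma :\: tau] raises the
    rank of [rho], so each is a cone point of the link of [rho], and these points
    can be added one by one to the face [tau :\: rho] of that link. *)

Section Rank.

Variables (S : finType) (M : matroid S).
Implicit Types (A B I J : {set S}) (x : S).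

Lemma indep_card_le_rank A I : I \in indep M -> I \subset A -> #|I| <= rank M A.
Proof.
by move=> indI sIA; apply: (leq_bigmax_cond (F := fun I => #|I|)); rewrite indI.
Qed.

Lemma rank_le_card A : rank M A <= #|A|.
Proof. by apply/bigmax_leqP => I /andP[_ sIA]; apply: subset_leq_card. Qed.

Lemma rankS A B : A \subset B -> rank M A <= rank M B.
Proof.
move=> sAB; apply/bigmax_leqP => I /andP[indI sIA].
exact: indep_card_le_rank indI (subset_trans sIA sAB).
Qed.

Lemma rank_basis A :
  exists I, [/\ I \in indep M, I \subset A & #|I| = rank M A].
Proof.
have ind0 : (set0 \in indep M) && (set0 \subset A) by rewrite indep0 sub0set.
have [|I /andP[indI sIA] rI] :=
  @eq_bigmax_cond _ [pred I | (I \in indep M) && (I \subset A)] (fun I => #|I|).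
  by apply/card_gt0P; exists set0.
by exists I; split=> //; rewrite -rI.
Qed.

(** Take [J] of maximal size among the independent sets between [I] and [A]; were it smaller than a
    basis of [A], the exchange axiom would enlarge it inside [A]. *)
Lemma indep_extend A I : I \in indep M -> I \subset A ->
  exists J, [/\ J \in indep M, I \subset J, J \subset A & #|J| = rank M A].
Proof.
move=> indI sIA.
pose P J := [&& J \in indep M, I \subset J & J \subset A].
have PI : P I by rewrite /P indI subxx.
case: (arg_maxnP (fun J => #|J|) PI) => J /and3P[indJ sIJ sJA] maxJ.
exists J; split=> //; apply/eqP; rewrite eqn_leq indep_card_le_rank //= leqNgt.
apply/negP; have [B [indB sBA <-]] := rank_basis A => ltJB.
have [x /setDP[xB xNJ] indxJ] := indep_exchange indJ indB ltJB.
have /maxJ : P (x |: J).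
  by rewrite /P indxJ subsetU ?sIJ ?orbT // subUset sub1set (subsetP sBA).
by rewrite /= cardsU1 xNJ add1n ltnn.
Qed.

(** Extend a basis [I] of [A :&: B] to a basis [J] of [A :|: B]. The traces of [J] on [A] and [B]
    are independent, cover [J], and meet in a set containing [I]. *)
Lemma rank_submod A B :
  rank M (A :|: B) + rank M (A :&: B) <= rank M A + rank M B.
Proof.
have [I [indI sI <-]] := rank_basis (A :&: B).
have sIU : I \subset A :|: B.
  by apply: subset_trans sI (subset_trans (subsetIl _ _) (subsetUl _ _)).
have [J [indJ sIJ sJ <-]] := indep_extend _ _ indI sIU.
have leJI C : #|J :&: C| <= rank M C.
  by rewrite indep_card_le_rank ?subsetIr // (indepS indJ) ?subsetIl.
apply: leq_trans (leq_add (leJI A) (leJI B)).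
rewrite -(cardsUI (J :&: A)) -setIUr -setIIr (setIidPl sJ) leq_add2l.
by rewrite subset_leq_card // subsetI sIJ.
Qed.

Lemma rank_augment A B : rank M A < rank M B ->
  exists2 x, x \in B :\: A & rank M A < rank M (x |: A).
Proof.
have [I [indI sIA rI]] := rank_basis A.
have [J [indJ sJB <-]] := rank_basis B.
rewrite -rI => /(indep_exchange indI indJ)[x /setDP[xJ xNI] indxI].
have ltx (C : {set S}) : x |: I \subset C -> #|I| < rank M C.
  by move=> /(indep_card_le_rank _ _ indxI); rewrite cardsU1 xNI.
exists x; last by rewrite ltx ?setUS.
(* Were [x] in [A], then [x |: I] would be an independent subset of [A] larger than its basis
   [I]. *)
rewrite inE (subsetP sJB) // andbT; apply/negP => xA.
by have := ltx A; rewrite subUset sub1set xA sIA rI ltnn => /(_ isT).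
Qed.

End Rank.

Lemma cone_points_setU (S : finType) (Gamma : {set {set S}}) (A B : {set S}) :
  {in A, forall x, cone_point Gamma x} -> B \in Gamma -> A :|: B \in Gamma.
Proof.
move=> coneA GB.
(* Induction on a list is enough: repetitions are harmless, as [cone_point] does not ask that [x]
   lie outside the face. *)
suff: forall s : seq S, {subset s <= A} -> [set x in s] :|: B \in Gamma.
  move=> /(_ (enum A)); rewrite set_enum; apply=> x.
  by rewrite mem_enum.
elim=> [|x s IHs] sA; first by rewrite set_nil set0U.
rewrite set_cons -setUA; apply: coneA; first by rewrite sA ?mem_head.
by apply: IHs => y ys; rewrite sA // inE ys orbT.
Qed.

Lemma strong_pseudo_independence_union (S : finType) (M : matroid S)
    (Delta : {set {set S}}) (sigma tau : {set S}) :
  strong_pseudo_independence_complex M Delta ->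
  sigma \in Delta -> tau \in Delta ->
  rank M sigma = rank M (sigma :&: tau) -> sigma :|: tau \in Delta.
Proof.
move=> [[cplx _] strong] Ds Dt eq_r; set rho := sigma :&: tau in eq_r.
have sub_rho : rho \subset sigma by exact: subsetIl.
have sub_rho_tau : rho \subset tau by exact: subsetIr.
have Drho : rho \in Delta by exact: cplx Ds sub_rho.
have cone : {in sigma :\: rho, forall x, cone_point (link rho Delta) x}.
  move=> x /setDP[xs xNrho].
  have sxr : x |: rho \subset sigma by rewrite subUset sub1set xs.
  apply: strong => //; last exact: cplx Ds sxr.
  (* The rank of [x |: rho] is squeezed between those of [rho] and [sigma], which agree. *)
  by apply/eqP; rewrite eqn_leq -{1}eq_r !rankS ?subsetUr.
have link_tau : tau :\: rho \in link rho Delta.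
  rewrite inE -setI_eq0 setIDAC setDIl setDv setI0 eqxx /=.
  by rewrite setUC -{1}(setIidPr sub_rho_tau) setID.
have := cone_points_setU _ _ _ _ cone link_tau; rewrite inE => /andP[_ Dall].
(* Adding [rho] back to the face of the link yields a face containing [sigma :|: tau]. *)
by apply: cplx Dall _; apply/subsetP => x; rewrite !inE; do 2!case: (x \in _).
Qed.

Theorem theorem5p3 (S : finType) (M : matroid S) (Delta : {set {set S}}) :
  Delta != set0 ->
  strong_pseudo_independence_complex M Delta ->
  semimatroid Delta (rank M).
Proof.
move=> Delta0 spi; have [[cplx pseudo] _] := spi; split=> //.
- by move=> sigma _; rewrite rank_le_card.
- by move=> sigma tau _ _; apply: rankS.
- by move=> sigma tau _ _ _; apply: rank_submod.
- by move=> sigma tau; apply: strong_pseudo_independence_union spi.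
- move=> sigma tau Ds _ /rank_augment[y /setDP[yt yNs] lt_r].
  by exists y; [rewrite inE yNs | apply: pseudo].
Qed.
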